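(* Let $0\le a<b$, $0\le c<d$, $\Delta=[a,b]\times[c,d]$, and let $f:\Delta\to\mathbb{R}$ be a partial differentiable mapping on $\Delta$ with $\frac{\partial^2 f}{\partial t\partial\lambda}\in L(\Delta)$. Let $q\ge 1$, let $s\in(0,1]$ be fixed, put $D:=\left|\frac{\partial^2 f}{\partial t\partial\lambda}\right|$, and suppose that $D^q$ is $s$-convex in the second sense on the co-ordinates on $\Delta$. Then for $x\in[a,b]$ and $y\in[c,d]$, $$\left|\frac{1}{(b-a)(d-c)}\left[A-(x-a)\int_c^d f(a,v)\,dv-(b-x)\int_c^d f(b,v)\,dv-(d-y)\int_a^b f(u,d)\,du-(y-c)\int_a^b f(u,c)\,du+\int_a^b\int_c^d f(u,v)\,du\,dv\right]\right|$$ $$\le\frac{2^{2-\frac{2}{q}}}{(s+1)^{2/q}(s+2)^{2/q}}\Bigg\{\frac{(x-a)^2(y-c)^2}{(b-a)(d-c)}\left\{D(x,y)^q+(s+1)D(x,c)^q+(s+1)D(a,y)^q+(s+1)^2D(a,c)^q\right\}^{1/q}$$ $$+\frac{(x-a)^2(d-y)^2}{(b-a)(d-c)}\left\{D(x,y)^q+(s+1)D(x,d)^q+(s+1)D(a,y)^q+(s+1)^2D(a,d)^q\right\}^{1/q}$$ $$+\frac{(b-x)^2(y-c)^2}{(b-a)(d-c)}\left\{D(x,y)^q+(s+1)D(x,c)^q+(s+1)D(b,y)^q+(s+1)^2D(b,c)^q\right\}^{1/q}$$ $$+\frac{(b-x)^2(d-y)^2}{(b-a)(d-c)}\left\{D(x,y)^q+(s+1)D(x,d)^q+(s+1)D(b,y)^q+(s+1)^2D(b,d)^q\right\}^{1/q}\Bigg\},$$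 where $$A=\frac{(x-a)(y-c)f(a,c)+(x-a)(d-y)f(a,d)}{(b-a)(d-c)}+\frac{(b-x)(y-c)f(b,c)+(b-x)(d-y)f(b,d)}{(b-a)(d-c)}.$$
   Context: $\frac{\partial^2 f}{\partial t\partial\lambda}(u,v)$ denotes the mixed second partial derivative of $f$ with respect to its first and second variables, evaluated at $(u,v)$; $L(\Delta)$ is the space of integrable functions on $\Delta$. In the double integral $u$ ranges over $[a,b]$ and $v$ over $[c,d]$. For $s\in(0,1]$, a function $g:[\alpha,\beta]\to\mathbb{R}$ with $[\alpha,\beta]\subset[0,\infty)$ is $s$-convex in the second sense if $g(\mu u+(1-\mu)v)\le\mu^s g(u)+(1-\mu)^s g(v)$ for all $u,v\in[\alpha,\beta]$, $\mu\in[0,1]$. A function $g:\Delta=[a,b]\times[c,d]\to\mathbb{R}$ with $\Delta\subset[0,\infty)^2$ is $s$-convex in the second sense on the co-ordinates on $\Delta$ if the partial mappings $u\mapsto g(u,y)$ on $[a,b]$ and $v\mapsto g(x,v)$ on $[c,d]$ are $s$-convex in the second sense for all $y\in[c,d]$ and $x\in[a,b]$.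
   Formalization: The denominators (b-a)(d-c) in the definition of A are dropped, since the outer factor already divides by them; as printed the claim fails for f = 1 on [0,2]×[0,1], where the left side is 1/2 and the right side is 0. *)

(* Defs.v *)
From mathcomp Require Import all_boot all_order all_algebra.
From mathcomp Require Import all_classical all_reals all_analysis.

Set Implicit Arguments.
Unset Strict Implicit.
Unset Printing Implicit Defensive.

Import Order.TTheory GRing.Theory Num.Theory.
Import numFieldNormedType.Exports.

Local Open Scope classical_set_scope.
Local Open Scope ring_scope.

(* A function on `[a, b] `*` `[c, d] is represented by a total f : R -> R -> R.
   Derivatives are taken relative to the interval, hence one-sided at the
   endpoints, so that the values of f outside the rectangle play no role. *)

Definition diff_quot (R : realType) (g : R -> R) (u w : R) : R :=
  (g w - g u) / (w - u).

Definition derivable_within (R : realType) (I : set R) (g : R -> R) (u : R)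
  : Prop := cvg (diff_quot g u w @[w --> within I u^']).

Definition derive_within (R : realType) (I : set R) (g : R -> R) (u : R) : R :=
  lim (diff_quot g u w @[w --> within I u^']).

Section Partials.
Variables (R : realType) (I J : set R) (f : R -> R -> R).

Definition partial2 (u v : R) : R := derive_within J (fun l => f u l) v.

(* d/dt (df/dl): the second variable is differentiated first. *)
Definition partial12 (u v : R) : R := derive_within I (fun t => partial2 t v) u.

(* The second clause guarantees that partial2, and the third that partial12,
   is an actual derivative at every point of I `*` J. *)
Definition partial_differentiable : Prop :=
  forall u v : R, I u -> J v ->
  [/\ derivable_within I (fun t => f t v) u,
      derivable_within J (fun l => f u l) v
    & derivable_within I (fun t => partial2 t v) u].

End Partials.

(* s-convexity in the second sense; 0 `^ s = 0 since s != 0 in all uses. *)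
Definition s_convex2 (R : realType) (s : R) (I : set R) (g : R -> R) : Prop :=
  forall u v mu : R, I u -> I v -> 0 <= mu <= 1 ->
  g (mu * u + (1 - mu) * v) <= mu `^ s * g u + (1 - mu) `^ s * g v.

Definition coord_s_convex2 (R : realType) (s : R) (I J : set R)
    (g : R -> R -> R) : Prop :=
  (forall y : R, J y -> s_convex2 s I (fun u => g u y)) /\
  (forall x : R, I x -> s_convex2 s J (fun v => g x v)).

(* Main.v *)
Require Import Defs.
From mathcomp Require Import all_boot all_order all_algebra.
From mathcomp Require Import all_classical all_reals all_analysis.
From mathcomp Require Import ring lra.

Set Implicit Arguments.
Unset Strict Implicit.
Unset Printing Implicit Defensive.

Import Order.TTheory GRing.Theory Num.Theory.
Import numFieldNormedType.Exports.

Local Open Scope classical_set_scope.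
Local Open Scope ring_scope.

(** The point (x, y) cuts the rectangle into four quadrants, each of which has
    one corner (p, r) of the rectangle. The bracket on the left-hand side is
    exactly the sum over the quadrants of the double integral of the rectangle
    increment
      f u v - f p v - (f u r - f p r),
    since expanding the four integrals makes the boundary terms appear one by
    one (bracket_eq_corner_integrals). Everything thus reduces to a bound
    on one corner integral (quadrant_le).

    The bound comes from the mean value theorem in the following form
    (increment_le_segment): if the derivative of h along the segment from p
    to x is at most w t at parameter t, and W is a primitive of w, then the
    increment of h at parameter t is at most |x - p| (W t - W 0). A pointwise
    bound of the mixed derivative is thus integrated once in each variable to
    bound the rectangle increment (rectangle_increment_le), and applying the
    same lemma to primitives of the continuous sections integrates once more
    in each variable to bound the corner integral (corner_integral_le).

    The pointwise bound must be linear in the convexity bound of D^q so that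
    its primitives are explicit. Young's inequality provides this: for every
    K > 0,
      D <= K^(1-q) D^q / q + (1 - 1/q) K,
    and coordinatewise s-convexity bounds D^q by a combination of the
    functions t^s and (1-t)^s in each variable with the values of D^q at the
    corners of the quadrant as coefficients (partial12_le). Their second
    primitives take at 1 the values 1/((s+1)(s+2)) and 1/(s+2), which is where
    the factors of the statement come from. Choosing the best K
    (young_optimal) recovers what the power mean inequality would give, a
    bound with the constant 4^(1/q - 1), which is at most 2^(2 - 2/q).

    The convexity bound also shows that the mixed derivative is bounded
    (partial12_bounded). This is what makes the inner integrals continuous in
    the outer variable (inner_integral_continuous) although f is only known to
    be continuous in each variable separately. *)

(** * Functions of one variable on a segment *)

Section OneVariable.
Variable R : realType.
Local Notation mu := (@lebesgue_measure R).
Implicit Types (a b p x t k : R) (h g w W v V : R -> R).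

Lemma ltW_itv a b x : a < x < b -> a <= x <= b.
Proof. by move=> /andP[/ltW-> /ltW->]. Qed.

Lemma segment_in_itv a b p x t : a <= p <= b -> a <= x <= b -> 0 <= t <= 1 ->
  a <= p + t * (x - p) <= b.
Proof. by move=> /andP[? ?] /andP[? ?] /andP[? ?]; apply/andP; split; nra. Qed.

Lemma segment_in_itvoo a b p x t : a <= p <= b -> a <= x <= b -> p != x ->
  0 < t < 1 -> a < p + t * (x - p) < b.
Proof.
move=> /andP[? ?] /andP[? ?] px /andP[? ?].
by have [|] : p < x \/ x < p; [case: ltgtP px => //; tauto| |] => ?;
   apply/andP; split; nra.
Qed.

Lemma within_continuous_cst (A : set R) k : {within A, continuous (fun=> k)}.
Proof. by apply: continuous_subspaceT => z; exact: cvg_cst. Qed.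

Lemma within_continuous_segment a b p x h : {within `[a, b], continuous h} ->
  a <= p <= b -> a <= x <= b ->
  {within `[0, 1], continuous (fun t => h (p + t * (x - p)))}.
Proof.
move=> /subspace_continuousP ch pab xab; apply/subspace_continuousP => t.
rewrite /= in_itv /= => t01.
have uab : `[a, b]%classic (p + t * (x - p)).
  by rewrite /= in_itv /=; exact: segment_in_itv.
apply: (@cvg_comp _ _ _ (fun t => p + t * (x - p)) h _
  (within `[a, b] (nbhs (p + t * (x - p))))); last exact: ch.
have e_cont : (fun t => p + t * (x - p)) @ t --> p + t * (x - p).
  by apply: cvgD; [exact: cvg_cst|apply: cvgM; [exact: cvg_id|exact: cvg_cst]].
move=> A hA; have := e_cont _ hA.
change (nbhs t [set z | `[a, b]%classic (p + z * (x - p)) -> A (p + z * (x - p))] ->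
  nbhs t [set z | `[0, 1]%classic z -> A (p + z * (x - p))]).
apply: filterS => z /= zA z01; apply: zA.
by rewrite in_itv/=; apply: segment_in_itv => //; rewrite in_itv in z01.
Qed.

Lemma derivable_within_itv_continuous a b h :
  (forall u, a <= u <= b -> derivable_within `[a, b] h u) ->
  {within `[a, b], continuous h}.
Proof.
move=> dh; apply/subspace_continuousP => u; rewrite /= in_itv/= => uab.
have /cvg_ex[l hl] := dh _ uab.
have idF : w @[w --> within `[a, b] u^'] --> u.
  apply: cvg_within_filter; exact: cvg_within.
(* h w is recovered from the difference quotient, which is bounded near u. *)
have hu : diff_quot h u w * (w - u) + h u @[w --> within `[a, b] u^'] --> h u.
  rewrite -[X in _ --> X]add0r -[X in _ --> X + _](mulr0 l) -(subrr u).
  by apply: cvgD; [apply: cvgM hl (cvgB idF _)|]; exact: cvg_cst.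
move=> A Au; have := hu _ Au.
change (nbhs u [set w | w != u -> `[a, b]%classic w ->
    A (diff_quot h u w * (w - u) + h u)] ->
  nbhs u [set w | `[a, b]%classic w -> A (h w)]).
apply: filterS => w /= nA wab.
have [->|wu] := eqVneq w u; first exact: nbhs_singleton.
by move: (nA wu wab); rewrite /diff_quot divfK ?subr_eq0// subrK.
Qed.

(** At an interior point the interval contains a neighbourhood, so that the
    relative derivative is the two-sided one. *)
Lemma derivable_within_is_derive a b h u : a < u < b ->
  derivable_within `[a, b] h u ->
  is_derive u 1 h (derive_within `[a, b] h u).
Proof.
move=> uab hl; rewrite /derivable_within in hl.
have hF : (diff_quot h u w @[w --> u^']) --> derive_within `[a, b] h u.
  move=> A /hl.
  change (nbhs u [set w | w != u -> `[a, b]%classic w -> A (diff_quot h u w)] ->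
    nbhs u [set w | w != u -> A (diff_quot h u w)]).
  move=> nA; near=> w => wu; have /= := near nA w; apply => //.
  apply: subset_itv_oo_cc; rewrite /=; near: w; apply: near_in_itvoo.
  by rewrite in_itv.
have hD : z^-1 *: (h (z *: (1 : R) + u) - h u) @[z --> 0^'] -->
    derive_within `[a, b] h u.
  move=> A /hF.
  change (nbhs u [set w | w != u -> A (diff_quot h u w)] ->
    nbhs (0 : R) [set z | z != 0 -> A (z^-1 *: (h (z *: (1 : R) + u) - h u))]).
  have e_cont : (fun z => z * (1 : R) + u) @ (0 : R) --> u.
    have : (fun z => z * (1 : R) + u) @ (0 : R) --> 0 * 1 + u.
      by apply: cvgD; [apply: cvgM; [exact: cvg_id|]|]; exact: cvg_cst.
    by rewrite mul0r add0r.
  move=> nA; have := e_cont _ nA.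
  change (nbhs (0 : R) [set z | z * 1 + u != u -> A (diff_quot h u (z * 1 + u))] ->
    nbhs (0 : R) [set z | z != 0 -> A (z^-1 *: (h (z *: (1 : R) + u) - h u))]).
  apply: filterS => z /= hz z0; have := hz _.
  rewrite /diff_quot addrK /GRing.scale/= mulr1 mulrC; apply.
  by rewrite -subr_eq0 addrK.
by apply: DeriveDef; [apply/cvg_ex; eexists; exact: hD|exact: (cvg_lim _ hD)].
Unshelve. all: by end_near. Qed.

Lemma lipschitz_within_continuous a b g k :
  (forall u z, a <= u <= b -> a <= z <= b -> `|g u - g z| <= k * `|u - z|) ->
  {within `[a, b], continuous g}.
Proof.
move=> gk; apply/subspace_continuousP => u; rewrite /= in_itv/= => uab.
have k0 : 0 < `|k| + 1 by rewrite ltr_wpDl.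
apply/cvgrPdist_le => e e0; rewrite near_withinE; near=> z => zab.
rewrite /= in_itv/= in zab.
apply: le_trans (gk _ _ uab zab) _; apply: (@le_trans _ _ ((`|k| + 1) * `|u - z|)).
  by apply: ler_wpM2r => //; have := ler_norm k; lra.
rewrite -ler_pdivlMl// mulrC; near: z.
by apply: cvgr_dist_le; [exact: cvg_id|exact: divr_gt0].
Unshelve. all: by end_near. Qed.

Definition primitive01 W w := {within `[0, 1], continuous W} /\
  forall t, 0 < t < 1 -> is_derive t 1 W (w t).

Lemma primitive01_eq W w V v : primitive01 W w -> W =1 V -> w =1 v ->
  primitive01 V v.
Proof. by move=> + /funext <- /funext <-. Qed.

Lemma primitive01D W w V v : primitive01 W w -> primitive01 V v ->
  primitive01 (fun t => W t + V t) (fun t => w t + v t).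
Proof.
move=> [cW dW] [cV dV]; split; first exact: within_continuousD.
by move=> t t01; apply: is_deriveD; [exact: dW|exact: dV].
Qed.

Lemma primitive01Z k W w : primitive01 W w ->
  primitive01 (fun t => k * W t) (fun t => k * w t).
Proof.
move=> [cW dW]; split.
  by move=> z; apply: cvgM; [exact: cvg_cst|exact: cW].
by move=> t /dW dWt; exact: is_deriveZ.
Qed.

Lemma primitive01_cst k : primitive01 (fun=> k) (fun=> 0).
Proof.
split; first exact: within_continuous_cst.
by move=> t _; exact: is_derive_cst.
Qed.

Lemma increment_le_primitive h h' W w : primitive01 h h' -> primitive01 W w ->
  (forall t, 0 < t < 1 -> `|h' t| <= w t) ->
  forall t, 0 <= t <= 1 -> `|h t - h 0| <= W t - W 0.
Proof.
move=> [ch dh] [cW dW] hw t /andP[t0 t1].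
have sub : `[0, t] `<=` `[0, 1 : R].
  by apply: subset_itvl; rewrite bnd_simp.
have mono_le (F F' : R -> R) : {within `[0, 1], continuous F} ->
    (forall z : R, 0 < z < 1 -> is_derive z 1 F (F' z)) ->
    (forall z : R, 0 < z < 1 -> 0 <= F' z) -> F 0 <= F t.
  move=> cF dF F'0; rewrite -subr_ge0.
  have [t0'|t0'] := ltP 0 t; last first.
    by have -> : t = 0 by [apply/eqP; rewrite eq_le t0' t0]; rewrite subrr.
  have [z|c] := @MVT _ F F' _ _ t0' _ (continuous_subspaceW sub cF).
    by rewrite in_itv/= => /andP[z0 zt]; apply: dF; rewrite z0/=; lra.
  rewrite in_itv/= => /andP[c0 ct] ->; apply: mulr_ge0; last lra.
  by apply: F'0; rewrite c0/=; lra.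
have hD := mono_le (fun z => W z + h z) (fun z => w z + h' z)
  (within_continuousD cW ch).
have hB := mono_le (fun z => W z - h z) (fun z => w z - h' z)
  (within_continuousB cW ch).
rewrite ler_norml; apply/andP; split.
- suff : W 0 + h 0 <= W t + h t by lra.
  apply: hD => z z01; first by apply: is_deriveD; [exact: dW|exact: dh].
  by have := hw _ z01; rewrite ler_norml => /andP[]; lra.
- suff : W 0 - h 0 <= W t - h t by lra.
  apply: hB => z z01; first by apply: is_deriveB; [exact: dW|exact: dh].
  by have := hw _ z01; rewrite ler_norml => /andP[]; lra.
Qed.

(** The parameter runs from p to x, in whichever order they lie, so that
    this single statement serves corners on both sides of x. *)
Lemma increment_le_segment a b p x h h' W w : {within `[a, b], continuous h} ->
  (forall u, a < u < b -> is_derive u 1 h (h' u)) ->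
  a <= p <= b -> a <= x <= b -> primitive01 W w ->
  (forall t, 0 < t < 1 -> `|h' (p + t * (x - p))| <= w t) ->
  forall t, 0 <= t <= 1 ->
    `|h (p + t * (x - p)) - h p| <= `|x - p| * (W t - W 0).
Proof.
move=> ch dh pab xab WW hw t t01.
have [px|px] := eqVneq p x.
  by rewrite -px subrr mulr0 addr0 subrr normr0 mul0r.
have xp0 : 0 < `|x - p| by rewrite normr_gt0 subr_eq0 eq_sym.
pose k z := h (p + z * (x - p)).
have -> : h p = k 0 by rewrite /k mul0r addr0.
rewrite -[h _]/(k t) mulrBr.
apply: (@increment_le_primitive k (fun z => (x - p) * h' (p + z * (x - p)))
  (fun z => `|x - p| * W z) (fun z => `|x - p| * w z)) => //.
- split; first exact: within_continuous_segment.
  move=> z z01.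
  have dk : is_derive (p + z * (x - p)) 1 h (h' (p + z * (x - p))).
    by apply: dh; exact: segment_in_itvoo.
  have de : is_derive z (1 : R) (fun z => p + z * (x - p)) (x - p).
    by apply: trigger_derive; rewrite /GRing.scale/=; ring.
  rewrite /= mulrC.
  exact: (@is_derive1_comp _ h (fun z => p + z * (x - p)) z _ _ dk de).
- exact: primitive01Z.
- by move=> z /hw hz; rewrite normrM ler_pM2l.
Qed.

(** A single primitive serves all subintervals, so that bounds on integrals
    become bounds on increments. *)
Lemma primitive_exists a b g : a < b -> {within `[a, b], continuous g} ->
  exists H, [/\ {within `[a, b], continuous H},
    forall u, a < u < b -> is_derive u 1 H (g u) &
    forall al be, a <= al -> al <= be -> be <= b ->
      \int[mu]_(u in `[al, be]) g u = H be - H al].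
Proof.
move=> ab cg.
have ig : mu.-integrable `[a, b] (EFin \o g).
  by apply: continuous_compact_integrable => //; exact: segment_compact.
exists (fun u => \int[mu]_(v in `[a, u]) g v); split.
- exact: parameterized_integral_continuous (ltW ab) ig.
- move=> u /andP[au ub].
  have [|dH <-] := continuous_FTC1_closed ub ig au.
    by apply: (within_continuous_continuous ab cg); rewrite in_itv/= au ub.
  by rewrite derive1E; exact/derivableP.
- move=> al be aal albe beb.
  rewrite Rintegral_itvB ?bnd_simp//; last first.
    by apply: integrableS ig => //; apply: subset_itvl; rewrite bnd_simp.
  rewrite Rintegral_itv_obnd_cbnd//; apply: integrableS ig => //.
  by apply: subset_itv; rewrite bnd_simp.
Qed.

(** The increment bound applied to a primitive of g: the integral is bounded
    by an explicit primitive of the bound. The minimum and maximum orient the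
    segment from p to x as an interval, in whichever order they lie. *)
Lemma integral_le_segment a b p x g W w : a < b ->
  {within `[a, b], continuous g} ->
  a <= p <= b -> a <= x <= b -> primitive01 W w ->
  (forall t, 0 < t < 1 -> `|g (p + t * (x - p))| <= w t) ->
  `| \int[mu]_(u in `[Num.min p x, Num.max p x]) g u | <=
  `|x - p| * (W 1 - W 0).
Proof.
move=> ab cg pab xab WW hw.
have [H [cH dH intH]] := primitive_exists ab cg.
have := increment_le_segment cH dH pab xab WW hw (t := 1).
rewrite lexx ler01 mul1r subrKC => /(_ isT); apply: le_trans.
move: pab xab => /andP[ap pb] /andP[ax xb].
by have [px|xp] := leP p x; rewrite intH ?(ltW xp)//; rewrite distrC.
Qed.

Lemma integrable_sub (al be ga de : R) g : {within `[al, be], continuous g} ->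
  al <= ga -> de <= be ->
  mu.-integrable `[ga, de] (EFin \o g).
Proof.
move=> cg alga debe; apply: continuous_compact_integrable.
  exact: segment_compact.
by apply: continuous_subspaceW cg; apply: subset_itv; rewrite bnd_simp.
Qed.

Lemma Rintegral_cst_itv (al be : R) k : al <= be ->
  \int[mu]_(u in `[al, be]) k = (be - al) * k.
Proof.
move=> albe; rewrite Rintegral_cst//= lebesgue_measure_itv/= lte_fin mulrC.
by case: ltgtP albe => //= -> _; rewrite subrr.
Qed.

Lemma Rintegral_itv_split (al m be : R) g : al < be ->
  al <= m <= be -> {within `[al, be], continuous g} ->
  \int[mu]_(u in `[al, be]) g u =
  \int[mu]_(u in `[al, m]) g u +
  \int[mu]_(u in `[m, be]) g u.
Proof.
move=> albe /andP[alm mbe] cg; have [H [_ _ HE]] := primitive_exists albe cg.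
rewrite !HE//; last exact: ltW.
by ring.
Qed.

End OneVariable.

(** * The weights of s-convexity and their primitives *)

Section Weights.
Variable R : realType.
Implicit Types r t : R.

Lemma within_continuous_powR r : 0 < r ->
  {within `[0, 1], continuous (fun t => t `^ r)}.
Proof.
move=> r0.
have cont t : 0 < t -> {for t, continuous (fun t : R => t `^ r)}.
  move=> t0; apply: differentiable_continuous; apply/derivable1_diffP.
  by apply: derivable_powR; rewrite in_itv/= t0.
apply/continuous_within_itvP => //; split.
- by move=> t; rewrite in_itv/= => /andP[t0 _]; exact: cont.
- by rewrite powR0 ?gt_eqF//; exact: powR_cvg0.
- by apply: cvg_at_left_filter; exact: cont.
Qed.

Lemma primitive01_powR r : 0 <= r ->
  primitive01 (fun t => t `^ (r + 1) / (r + 1)) (fun t => t `^ r).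
Proof.
move=> r0; split.
  move=> z; apply: cvgM; last exact: cvg_cst.
  by apply: within_continuous_powR; lra.
move=> t /andP[t0 _].
have dP := is_derive1_powR (r + 1) t0.
rewrite (_ : (fun t => _) = (fun t : R => (r + 1)^-1 * t `^ (r + 1))); last first.
  by apply/funext => z; rewrite mulrC.
rewrite (_ : t `^ r = (r + 1)^-1 * ((r + 1) * t `^ (r + 1 - 1))).
  exact: is_deriveZ.
by rewrite addrK mulKf//; lra.
Qed.

Lemma primitive01_powR_onem r : 0 <= r ->
  primitive01 (fun t => - ((1 - t) `^ (r + 1) / (r + 1))) (fun t => (1 - t) `^ r).
Proof.
move=> r0; have [cW dW] := primitive01_powR r0; split.
  have := within_continuous_segment cW (p := 1) (x := 0).
  rewrite !ler01 !lexx/= => /(_ isT isT) cV.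
  rewrite (_ : (fun t => - _) =
    (fun t => - ((1 + t * (0 - 1)) `^ (r + 1) / (r + 1)))).
    by move=> z; apply: cvgN; exact: cV.
  by apply/funext => t; congr (- (_ `^ _ / _)); ring.
move=> t t01.
have dU : is_derive (1 - t) 1 (fun t : R => t `^ (r + 1) / (r + 1)) ((1 - t) `^ r).
  by apply: dW; move: t01 => /andP[? ?]; apply/andP; split; lra.
have de : is_derive t (1 : R) (fun t => 1 - t) (-1).
  by apply: trigger_derive; rewrite /GRing.scale/=; ring.
rewrite -[X in is_derive _ _ _ X]mulr1 -mulrNN mulNr.
have dC := @is_derive1_comp R (fun t => t `^ (r + 1) / (r + 1))
  (fun t => 1 - t) t _ _ dU de.
exact: is_deriveN dC.
Qed.

Variable s : R.
Hypothesis s0 : 0 < s.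
Implicit Types (A B C : R) (k i j : nat).

Let s1_neq0 : s + 1 != 0. Proof. by apply: lt0r_neq0; rewrite addr_gt0. Qed.
Let s2_neq0 : s + 2 != 0. Proof. by apply: lt0r_neq0; rewrite addr_gt0. Qed.
Let s11 : s + 1 + 1 = s + 2. Proof. by rewrite -addrA. Qed.

(** The three elements of the basis at level 0 are t^s, (1-t)^s and 1; levels 1
    and 2 are their first and second primitives that vanish at 0. *)
Definition rise k t := match k with
  | 0%N => t `^ s
  | 1%N => t `^ (s + 1) / (s + 1)
  | _ => t `^ (s + 2) / ((s + 1) * (s + 2)) end.

Definition fall k t := match k with
  | 0%N => (1 - t) `^ s
  | 1%N => (1 - (1 - t) `^ (s + 1)) / (s + 1)
  | _ => t / (s + 1) - (1 - (1 - t) `^ (s + 2)) / ((s + 1) * (s + 2)) end.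

Definition monom k t := match k with 0%N => 1 | 1%N => t | _ => t ^+ 2 / 2 end.

Lemma rise_primitive k : (k < 2)%N -> primitive01 (rise k.+1) (rise k).
Proof.
case: k => [|[|//]] _; first by apply: primitive01_powR; exact: ltW.
have s1 : 0 <= s + 1 by rewrite addr_ge0// ltW.
apply: primitive01_eq (primitive01Z (s + 1)^-1 (primitive01_powR s1)) _ _ => t /=.
  by rewrite s11; field; rewrite s1_neq0 s2_neq0.
by rewrite mulrC.
Qed.

Lemma monom_primitive k : (k < 2)%N -> primitive01 (monom k.+1) (monom k).
Proof.
case: k => [|[|//]] _; split => /=.
- by apply: continuous_subspaceT => z; exact: cvg_id.
- by move=> t _; exact: is_derive_id.
- have : continuous (fun t : R => t ^+ 2 / 2).
    by move=> z; apply: cvgM; [exact: exprn_continuous|exact: cvg_cst].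
  exact: continuous_subspaceT.
- by move=> t _; apply: trigger_derive; rewrite /GRing.scale/=; field.
Qed.

Lemma fall_primitive k : (k < 2)%N -> primitive01 (fall k.+1) (fall k).
Proof.
case: k => [|[|//]] _.
  apply: primitive01_eq (primitive01D (primitive01_cst (s + 1)^-1)
    (primitive01_powR_onem (ltW s0))) _ _ => t /=; last by rewrite add0r.
  by field; rewrite s1_neq0.
have s1 : 0 <= s + 1 by rewrite addr_ge0// ltW.
apply: primitive01_eq (primitive01D
  (primitive01_cst (- ((s + 1) * (s + 2))^-1)) (primitive01D
    (primitive01Z (s + 1)^-1 (monom_primitive (k := 0) isT))
    (primitive01Z (- (s + 1)^-1) (primitive01_powR_onem s1)))) _ _ => t /=.
  by rewrite s11; field; rewrite s1_neq0 s2_neq0.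
by field; rewrite s1_neq0.
Qed.

Definition weight k A B C t := A * rise k t + B * fall k t + C * monom k t.

Lemma weight_primitive k A B C : (k < 2)%N ->
  primitive01 (weight k.+1 A B C) (weight k A B C).
Proof.
move=> k2; apply: primitive01D; last exact/primitive01Z/monom_primitive.
apply: primitive01D; first exact/primitive01Z/rise_primitive.
exact/primitive01Z/fall_primitive.
Qed.

Lemma weightS_0 k A B C : weight k.+1 A B C 0 = 0.
Proof.
rewrite /weight; case: k => [|k] /=; rewrite subr0 powR1 powR0//.
  by rewrite subrr !mul0r !mulr0 !addr0.
by rewrite subrr !mul0r expr0n /= !mul0r subr0 !mulr0 !addr0.
Qed.

Lemma weight2_1 A B C :
  weight 2 A B C 1 = A / ((s + 1) * (s + 2)) + B / (s + 2) + C / 2.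
Proof.
rewrite /weight /= subrr powR1 powR0//.
by field; rewrite s1_neq0 s2_neq0.
Qed.

(** A tensor combination of the basis: A11, A10, A01 and A00 are the
    coefficients of the products of rises and falls, and C that of the constant
    product, at level i in the first variable and j in the second. *)
Definition biweight i j A11 A10 A01 A00 C t t' :=
  weight i (weight j A11 A10 0 t') (weight j A01 A00 0 t') (weight j 0 0 C t') t.

Lemma biweightC i j A11 A10 A01 A00 C t t' :
  biweight i j A11 A10 A01 A00 C t t' =
  weight j (weight i A11 A01 0 t) (weight i A10 A00 0 t) (weight i 0 0 C t) t'.
Proof. by rewrite /biweight /weight; ring. Qed.

Lemma biweight_primitive_l i j A11 A10 A01 A00 C t' : (i < 2)%N ->
  primitive01 (fun t => biweight i.+1 j A11 A10 A01 A00 C t t')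
    (fun t => biweight i j A11 A10 A01 A00 C t t').
Proof. exact: weight_primitive. Qed.

Lemma biweight_primitive_r i j A11 A10 A01 A00 C t : (j < 2)%N ->
  primitive01 (biweight i j.+1 A11 A10 A01 A00 C t)
    (biweight i j A11 A10 A01 A00 C t).
Proof.
move=> j2; apply: primitive01_eq (weight_primitive _ _ _ j2) _ _ => t';
  rewrite biweightC; reflexivity.
Qed.

Lemma biweight_0l i j A11 A10 A01 A00 C t' :
  biweight i.+1 j A11 A10 A01 A00 C 0 t' = 0.
Proof. exact: weightS_0. Qed.

Lemma biweight_0r i j A11 A10 A01 A00 C t :
  biweight i j.+1 A11 A10 A01 A00 C t 0 = 0.
Proof. by rewrite biweightC weightS_0. Qed.

Lemma biweight_cst i j C t t' :
  biweight i j 0 0 0 0 C t t' = C * monom i t * monom j t'.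
Proof. by rewrite /biweight /weight; ring. Qed.

Lemma biweight00_affine (al : R) A11 A10 A01 A00 C t t' :
  biweight 0 0 (al * A11) (al * A10) (al * A01) (al * A00) C t t' =
  al * biweight 0 0 A11 A10 A01 A00 0 t t' + C.
Proof. by rewrite /biweight /weight /=; ring. Qed.

Lemma biweight00_le A11 A10 A01 A00 C t t' :
  0 <= A11 -> 0 <= A10 -> 0 <= A01 -> 0 <= A00 ->
  0 <= t <= 1 -> 0 <= t' <= 1 ->
  biweight 0 0 A11 A10 A01 A00 C t t' <= A11 + A10 + A01 + A00 + C.
Proof.
have powR01 (w : R) : 0 <= w <= 1 -> 0 <= w `^ s <= 1.
  move=> /andP[w0 w1]; rewrite powR_ge0/=.
  have := ge0_ler_powR (ltW s0) (x := w) (y := 1).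
  by rewrite powR1 !nnegrE; apply.
have onem01 (w : R) : 0 <= w <= 1 -> 0 <= 1 - w <= 1.
  by move=> /andP[? ?]; apply/andP; split; lra.
have le_mul (A T Z : R) : 0 <= A -> 0 <= T <= 1 -> 0 <= Z <= 1 -> A * (T * Z) <= A.
  by move=> A0 /andP[T0 T1] /andP[Z0 Z1]; rewrite ler_piMr// mulr_ile1.
move=> p11 p10 p01 p00 t01 z01.
have [tt zz] := (powR01 _ t01, powR01 _ z01).
have [t't z'z] := (powR01 _ (onem01 _ t01), powR01 _ (onem01 _ z01)).
have h11 := le_mul _ _ _ p11 tt zz.
have h10 := le_mul _ _ _ p10 tt z'z.
have h01 := le_mul _ _ _ p01 t't zz.
have h00 := le_mul _ _ _ p00 t't z'z.
by rewrite /biweight /weight /=; lra.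
Qed.

(** Twice integrated in each variable, the bound produces the weighted sum of
    corner values that appears in the statement. *)
Lemma biweight22_1 al A11 A10 A01 A00 C :
  biweight 2 2 (al * A11) (al * A10) (al * A01) (al * A00) C 1 1 =
  al * ((A11 + (s + 1) * A10 + (s + 1) * A01 + (s + 1) ^+ 2 * A00)
    / ((s + 1) ^+ 2 * (s + 2) ^+ 2)) + C / 4.
Proof. by rewrite /biweight !weight2_1; field; rewrite s1_neq0 s2_neq0. Qed.

End Weights.

(** * Rectangle increments and their integrals *)

Section Rectangle.
Variables (R : realType) (a b c d : R) (f : R -> R -> R).
Hypotheses (ab : a < b) (cd : c < d).
Hypothesis hf : partial_differentiable `[a, b] `[c, d] f.
Local Notation mu := (@lebesgue_measure R).
Local Notation f2 := (partial2 `[c, d] f).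
Local Notation f12 := (partial12 `[a, b] `[c, d] f).
Implicit Types (p x r y u v t z s : R).

Let diff_at u v : a <= u <= b -> c <= v <= d ->
  [/\ derivable_within `[a, b] (f ^~ v) u, derivable_within `[c, d] (f u) v
    & derivable_within `[a, b] (f2 ^~ v) u].
Proof. by move=> uab vcd; apply: hf; rewrite /= in_itv. Qed.

Lemma section1_continuous v : c <= v <= d ->
  {within `[a, b], continuous (f ^~ v)}.
Proof.
move=> vcd; apply: derivable_within_itv_continuous => u uab.
by have [] := diff_at uab vcd.
Qed.

Lemma section2_continuous u : a <= u <= b -> {within `[c, d], continuous (f u)}.
Proof.
move=> uab; apply: derivable_within_itv_continuous => v vcd.
by have [] := diff_at uab vcd.
Qed.

Lemma partial2_continuous v : c <= v <= d ->
  {within `[a, b], continuous (f2 ^~ v)}.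
Proof.
move=> vcd; apply: derivable_within_itv_continuous => u uab.
by have [] := diff_at uab vcd.
Qed.

(** The order of the two steps follows that of the derivatives: partial12
    differentiates partial2 in the first variable. *)
Lemma rectangle_increment_le s A11 A10 A01 A00 C p x r y : 0 < s ->
  a <= p <= b -> a <= x <= b -> c <= r <= d -> c <= y <= d ->
  (forall t z, 0 < t < 1 -> 0 < z < 1 ->
    `|f12 (p + t * (x - p)) (r + z * (y - r))|
      <= biweight s 0 0 A11 A10 A01 A00 C t z) ->
  forall t z, 0 <= t <= 1 -> 0 <= z <= 1 ->
  `|f (p + t * (x - p)) (r + z * (y - r)) - f p (r + z * (y - r))
     - (f (p + t * (x - p)) r - f p r)|
    <= `|x - p| * `|y - r| * biweight s 1 1 A11 A10 A01 A00 C t z.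
Proof.
move=> s0 pab xab rcd ycd hb t z t01 z01.
have uab := segment_in_itv pab xab t01.
(* Integrate the bound of the mixed derivative in the first variable, at a
   fixed ordinate. *)
have step1 w : 0 < w < 1 ->
    `|f2 (p + t * (x - p)) (r + w * (y - r)) - f2 p (r + w * (y - r))|
      <= `|x - p| * biweight s 1 0 A11 A10 A01 A00 C t w.
  move=> w01; have vcd : c <= r + w * (y - r) <= d.
    by apply: segment_in_itv => //; move: w01 => /andP[/ltW-> /ltW->].
  have := increment_le_segment (partial2_continuous vcd) _ pab xab
    (biweight_primitive_l s0 0 _ _ _ _ _ _ (i := 0) isT)
    (fun t t01 => hb t w t01 w01) t01.
  rewrite biweight_0l// subr0; apply=> u u_oo.
  apply: derivable_within_is_derive => //.
  by have [] := diff_at (ltW_itv u_oo) vcd.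
(* Then integrate in the second variable. *)
pose D v := f (p + t * (x - p)) v - f p v.
pose D' v := f2 (p + t * (x - p)) v - f2 p v.
have cD : {within `[c, d], continuous D}.
  by apply: within_continuousB; exact: section2_continuous.
have dD v : c < v < d -> is_derive v 1 D (D' v).
  move=> v_oo; have v_cc := ltW_itv v_oo.
  have [_ d1 _] := diff_at uab v_cc; have [_ d2 _] := diff_at pab v_cc.
  by apply: is_deriveB; exact: derivable_within_is_derive.
have WW := primitive01Z `|x - p|
  (biweight_primitive_r s0 1 A11 A10 A01 A00 C t (j := 0) isT).
have := increment_le_segment cD dD rcd ycd WW step1 z01.
by rewrite biweight_0r// mulr0 subr0 mulrA (mulrC `|y - r|).
Qed.

Lemma rectangle_increment_le_cst C p x r y :
  (forall u v, a <= u <= b -> c <= v <= d -> `|f12 u v| <= C) ->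
  a <= p <= b -> a <= x <= b -> c <= r <= d -> c <= y <= d ->
  `|f x y - f p y - (f x r - f p r)| <= `|x - p| * `|y - r| * C.
Proof.
move=> fC pab xab rcd ycd.
have le01 : 0 <= (1 : R) <= 1 by rewrite lexx ler01.
have hb t z : 0 < t < 1 -> 0 < z < 1 ->
    `|f12 (p + t * (x - p)) (r + z * (y - r))| <= biweight 1 0 0 0 0 0 0 C t z.
  move=> /ltW_itv t01 /ltW_itv z01; rewrite biweight_cst /= !mulr1.
  by apply: fC; exact: segment_in_itv.
have := rectangle_increment_le ltr01 pab xab rcd ycd hb le01 le01.
by rewrite biweight_cst /= !mulr1 !mul1r !subrKC.
Qed.

Section Integrals.
Variable C : R.
Hypothesis f12_le : forall u v, a <= u <= b -> c <= v <= d -> `|f12 u v| <= C.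

Let increment_continuous p r u : a <= p <= b -> a <= u <= b ->
  {within `[c, d], continuous (fun v => f u v - f p v - (f u r - f p r))}.
Proof.
move=> pab uab; apply: within_continuousB; last exact: within_continuous_cst.
by apply: within_continuousB; exact: section2_continuous.
Qed.

Lemma integral_rectangle_increment ga de p r u : c <= ga -> ga <= de -> de <= d ->
  a <= p <= b -> a <= u <= b ->
  \int[mu]_(v in `[ga, de]) (f u v - f p v - (f u r - f p r)) =
  \int[mu]_(v in `[ga, de]) f u v - \int[mu]_(v in `[ga, de]) f p v
    - (de - ga) * (f u r - f p r).
Proof.
move=> cga gade ded pab uab.
have ic := integrable_sub (section2_continuous _) cga ded.
rewrite RintegralB//; last 2 first.
- apply: (@integrable_sub _ c d _ _ (fun v => f u v - f p v)) => //.
  by apply: within_continuousB; exact: section2_continuous.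
- by apply: (@integrable_sub _ c d) => //; exact: within_continuous_cst.
by rewrite Rintegral_cst_itv// RintegralB//; apply: ic.
Qed.

(** Only separate continuity of f is available, so continuity under the integral
    sign is obtained from the increments: up to a multiple of one section of f,
    the inner integral is Lipschitz. *)
Lemma inner_integral_continuous ga de : c <= ga -> ga <= de -> de <= d ->
  {within `[a, b], continuous (fun u => \int[mu]_(v in `[ga, de]) f u v)}.
Proof.
move=> cga gade ded.
have gacd : c <= ga <= d by rewrite cga (le_trans gade).
have decd : c <= de <= d by rewrite ded (le_trans cga).
pose g u := \int[mu]_(v in `[ga, de]) f u v - (de - ga) * f u ga.
have cg : {within `[a, b], continuous g}.
  apply: (@lipschitz_within_continuous _ _ _ _ (`|de - ga| * (`|de - ga| * C)))
    => u v uab vab.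
  have -> : g u - g v =
      \int[mu]_(w in `[ga, de]) (f u w - f v w - (f u ga - f v ga)).
    by rewrite integral_rectangle_increment// /g; ring.
  have ch := increment_continuous (r := ga) vab uab.
  have WW := primitive01Z (`|u - v| * (`|de - ga| * C)) (monom_primitive R (k := 0) isT).
  have := integral_le_segment cd ch gacd decd WW.
  rewrite min_l// max_r// /= mulr1 mulr0 subr0 => /(_ _) hW.
  rewrite (_ : _ * `|u - v| = `|de - ga| * (`|u - v| * (`|de - ga| * C)));
    last by ring.
  apply: hW.
  move=> t /andP[/ltW t0 /ltW t1].
  have t01 : 0 <= t <= 1 by rewrite t0.
  apply: le_trans (rectangle_increment_le_cst f12_le vab uab gacd
    (segment_in_itv gacd decd t01)) _.
  rewrite mulrA; apply: ler_wpM2r.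
    by apply: le_trans (f12_le uab gacd).
  apply: ler_wpM2l => //; rewrite addrC addKr normrM ger0_norm//.
  exact: ler_piMl.
rewrite (_ : (fun u => _) = (fun u => g u + (de - ga) * f u ga)).
  move=> u; apply: cvgD; first exact: cg.
  by apply: cvgM; [exact: cvg_cst|exact: section1_continuous].
by apply/funext => u; rewrite /g subrK.
Qed.

Definition corner_integral p r al be ga de := \int[mu]_(u in `[al, be])
  (\int[mu]_(v in `[ga, de]) (f u v - f p v - (f u r - f p r))).

Let inner ga de p r u := \int[mu]_(v in `[ga, de]) f u v
  - \int[mu]_(v in `[ga, de]) f p v - (de - ga) * (f u r - f p r).

Let innerE al be ga de p r : a <= al -> be <= b -> c <= ga -> ga <= de ->
  de <= d -> a <= p <= b ->
  corner_integral p r al be ga de = \int[mu]_(u in `[al, be]) inner ga de p r u.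
Proof.
move=> aal beb cga gade ded pab; apply: eq_Rintegral => u.
rewrite inE/= in_itv/= => /andP[alu ube].
by apply: integral_rectangle_increment => //; rewrite (le_trans aal)// (le_trans ube).
Qed.

Let sectionB_continuous p r : c <= r <= d ->
  {within `[a, b], continuous (fun u => f u r - f p r)}.
Proof.
move=> rcd; apply: within_continuousB; last exact: within_continuous_cst.
exact: section1_continuous.
Qed.

Let scaled_sectionB_continuous p r k : c <= r <= d ->
  {within `[a, b], continuous (fun u => k * (f u r - f p r))}.
Proof.
by move=> rcd u; apply: cvgM; [exact: cvg_cst|exact: sectionB_continuous].
Qed.

Let innerB_continuous ga de p : c <= ga -> ga <= de -> de <= d ->
  {within `[a, b], continuous (fun u => \int[mu]_(v in `[ga, de]) f u v
     - \int[mu]_(v in `[ga, de]) f p v)}.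
Proof.
move=> cga gade ded; apply: within_continuousB; last exact: within_continuous_cst.
exact: inner_integral_continuous.
Qed.

Lemma corner_integralE p r al be ga de : a <= al -> al <= be -> be <= b ->
  c <= ga -> ga <= de -> de <= d -> a <= p <= b -> c <= r <= d ->
  corner_integral p r al be ga de =
  \int[mu]_(u in `[al, be]) (\int[mu]_(v in `[ga, de]) f u v)
     - (be - al) * \int[mu]_(v in `[ga, de]) f p v
     - (de - ga) * (\int[mu]_(u in `[al, be]) f u r - (be - al) * f p r).
Proof.
move=> aal albe beb cga gade ded pab rcd; rewrite innerE//.
have I g cg := @integrable_sub _ a b al be g cg aal beb.
rewrite /inner RintegralB//; last 2 first.
- exact/I/innerB_continuous.
- exact/I/scaled_sectionB_continuous.
rewrite RintegralB//; last 2 first.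
- exact/I/inner_integral_continuous.
- exact/I/within_continuous_cst.
rewrite RintegralZl//; last exact/I/sectionB_continuous.
rewrite RintegralB//; last 2 first.
- exact/I/section1_continuous.
- exact/I/within_continuous_cst.
by rewrite !Rintegral_cst_itv.
Qed.

(** The inner integral is bounded by one application of integral_le_segment to
    the bound of the rectangle increment, which raises the level in the second
    variable; the outer one raises it in the first. Each integration adds a
    factor x - p or y - r, which squares those of the increment. *)
Lemma corner_integral_le s A11 A10 A01 A00 K p x r y al be ga de :
  0 < s ->
  a <= p <= b -> a <= x <= b -> c <= r <= d -> c <= y <= d ->
  (forall t z, 0 < t < 1 -> 0 < z < 1 ->
    `|f12 (p + t * (x - p)) (r + z * (y - r))|
      <= biweight s 0 0 A11 A10 A01 A00 K t z) ->
  Num.min p x = al -> Num.max p x = be ->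
  Num.min r y = ga -> Num.max r y = de ->
  `|corner_integral p r al be ga de|
  <= (x - p) ^+ 2 * (y - r) ^+ 2 * biweight s 2 2 A11 A10 A01 A00 K 1 1.
Proof.
move=> s0 pab xab rcd ycd hb alE beE gaE deE.
have aal : a <= al.
  by rewrite -alE le_min; move: pab xab => /andP[-> _] /andP[-> _].
have beb : be <= b.
  by rewrite -beE ge_max; move: pab xab => /andP[_ ->] /andP[_ ->].
have cga : c <= ga.
  by rewrite -gaE le_min; move: rcd ycd => /andP[-> _] /andP[-> _].
have ded : de <= d.
  by rewrite -deE ge_max; move: rcd ycd => /andP[_ ->] /andP[_ ->].
have gade : ga <= de by rewrite -gaE -deE ge_min !le_max lexx.
rewrite innerE//.
have ck : {within `[a, b], continuous (inner ga de p r)}.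
  apply: within_continuousB; first exact: innerB_continuous.
  exact: scaled_sectionB_continuous.
have kb t : 0 < t < 1 -> `|inner ga de p r (p + t * (x - p))| <=
    (`|x - p| * `|y - r| ^+ 2) * biweight s 1 2 A11 A10 A01 A00 K t 1.
  move=> /ltW_itv t01; have uab := segment_in_itv pab xab t01.
  rewrite /inner -integral_rectangle_increment//.
  have WW := primitive01Z (`|x - p| * `|y - r|)
    (biweight_primitive_r s0 1 A11 A10 A01 A00 K t (j := 1) isT).
  have := integral_le_segment cd (increment_continuous (r := r) pab uab) rcd ycd WW.
  rewrite gaE deE biweight_0r// mulr0 subr0 => hW.
  rewrite (_ : _ * biweight _ _ _ _ _ _ _ _ _ _ = `|y - r| * (`|x - p| * `|y - r|
    * biweight s 1 2 A11 A10 A01 A00 K t 1)); last by ring.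
  by apply: hW => z /ltW_itv z01; exact: rectangle_increment_le.
have := integral_le_segment ab ck pab xab (primitive01Z _
  (biweight_primitive_l s0 _ _ _ _ _ _ _ (i := 1) isT)) kb.
rewrite alE beE biweight_0l// mulr0 subr0 => /le_trans; apply.
rewrite -[X in _ <= X * _ * _]real_normK ?num_real//.
rewrite -[X in _ <= _ * X * _]real_normK ?num_real//.
rewrite le_eqVlt; apply/orP; left; apply/eqP; ring.
Qed.

(** Each edge of the rectangle is cut into edges of two adjacent quadrants,
    whose corner integrals contain the two pieces of the edge integral with the
    same factor, so that the pieces add up. *)
Lemma bracket_eq_corner_integrals x y : a <= x <= b -> c <= y <= d ->
  (x - a) * (y - c) * f a c + (x - a) * (d - y) * f a d
    + ((b - x) * (y - c) * f b c + (b - x) * (d - y) * f b d)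
    - (x - a) * \int[mu]_(v in `[c, d]) f a v
    - (b - x) * \int[mu]_(v in `[c, d]) f b v
    - (d - y) * \int[mu]_(u in `[a, b]) f u d
    - (y - c) * \int[mu]_(u in `[a, b]) f u c
    + \int[mu]_(u in `[a, b]) (\int[mu]_(v in `[c, d]) f u v) =
  corner_integral a c a x c y + corner_integral a d a x y d
    + corner_integral b c x b c y + corner_integral b d x b y d.
Proof.
move=> hx hy; have [[ax xb] [cy yd]] := (andP hx, andP hy).
have aab : a <= a <= b by rewrite lexx ltW.
have bab : a <= b <= b by rewrite lexx ltW.
have ccd : c <= c <= d by rewrite lexx ltW.
have dcd : c <= d <= d by rewrite lexx ltW.
rewrite !corner_integralE//.
pose G1 u := \int[mu]_(v in `[c, y]) f u v.
pose G2 u := \int[mu]_(v in `[y, d]) f u v.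
have GE u : a <= u <= b -> \int[mu]_(v in `[c, d]) f u v = G1 u + G2 u.
  by move=> uab; apply: Rintegral_itv_split => //; exact: section2_continuous.
have cG1 : {within `[a, b], continuous G1} by exact: inner_integral_continuous.
have cG2 : {within `[a, b], continuous G2} by exact: inner_integral_continuous.
have GGE : \int[mu]_(u in `[a, b]) (\int[mu]_(v in `[c, d]) f u v) =
    \int[mu]_(u in `[a, x]) (\int[mu]_(v in `[c, y]) f u v)
    + \int[mu]_(u in `[x, b]) (\int[mu]_(v in `[c, y]) f u v)
    + (\int[mu]_(u in `[a, x]) (\int[mu]_(v in `[y, d]) f u v)
    + \int[mu]_(u in `[x, b]) (\int[mu]_(v in `[y, d]) f u v)).
  rewrite -!Rintegral_itv_split// -RintegralD//; last 2 first.
  - exact: (integrable_sub cG1 (lexx a) (lexx b)).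
  - exact: (integrable_sub cG2 (lexx a) (lexx b)).
  by apply: eq_Rintegral => u; rewrite inE/= in_itv/= => /GE.
rewrite GGE (GE a)// (GE b)// (Rintegral_itv_split ab hx (section1_continuous dcd)).
rewrite (Rintegral_itv_split ab hx (section1_continuous ccd)).
cbv beta; rewrite -/(G1 a) -/(G1 b) -/(G2 a) -/(G2 b).
(* The integrals become variables, so that ring does not try to unify them. *)
move: (G1 a) (G1 b) (G2 a) (G2 b) => G1a G1b G2a G2b.
move: (\int[mu]_(u in `[a, x]) f u d) (\int[mu]_(u in `[x, b]) f u d)
  (\int[mu]_(u in `[a, x]) f u c) (\int[mu]_(u in `[x, b]) f u c)
  => Fd1 Fd2 Fc1 Fc2.
move: (\int[mu]_(u in `[a, x]) (\int[mu]_(v in `[c, y]) f u v))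
  (\int[mu]_(u in `[x, b]) (\int[mu]_(v in `[c, y]) f u v))
  (\int[mu]_(u in `[a, x]) (\int[mu]_(v in `[y, d]) f u v))
  (\int[mu]_(u in `[x, b]) (\int[mu]_(v in `[y, d]) f u v)) => I1 I2 I3 I4.
move: (f a c) (f a d) (f b c) (f b d) => fac fad fbc fbd.
by ring.
Qed.

End Integrals.
End Rectangle.

(** * Convexity and Young's inequality *)

Lemma coord_s_convex2_le (R : realType) (s : R) (I J : set R) (g : R -> R -> R)
    (p x r y t z : R) :
  coord_s_convex2 s I J g -> I p -> I x -> J r -> J y ->
  J (r + z * (y - r)) -> 0 <= t <= 1 -> 0 <= z <= 1 ->
  g (p + t * (x - p)) (r + z * (y - r)) <=
  biweight s 0 0 (g x y) (g x r) (g p y) (g p r) 0 t z.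
Proof.
move=> [cI cJ] Ip Ix Jr Jy Jv t01 z01.
have -> : p + t * (x - p) = t * x + (1 - t) * p by ring.
apply: le_trans (cI _ Jv _ _ _ Ix Ip t01) _.
have vE : r + z * (y - r) = z * y + (1 - z) * r by ring.
have hx := cJ _ Ix _ _ _ Jy Jr z01.
have hp := cJ _ Ip _ _ _ Jy Jr z01.
rewrite vE (_ : biweight _ _ _ _ _ _ _ _ _ _ =
    t `^ s * (z `^ s * g x y + (1 - z) `^ s * g x r)
    + (1 - t) `^ s * (z `^ s * g p y + (1 - z) `^ s * g p r)).
  by apply: lerD; apply: ler_wpM2l; rewrite ?powR_ge0.
by rewrite /biweight /weight /=; ring.
Qed.

(** Weighted Young inequality: D^q is bounded from below by the tangent at K of
    the convex function D |-> D^q. *)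
Lemma young_powR (R : realType) (q K D : R) : 1 <= q -> 0 < K -> 0 <= D ->
  D <= q^-1 * K `^ (1 - q) * D `^ q + (1 - q^-1) * K.
Proof.
move=> q1 K0 D0; have q0 : 0 < q by exact: lt_le_trans q1.
have qn0 : q != 0 by exact: lt0r_neq0.
move: q1; rewrite le_eqVlt => /predU1P[<-|q1].
  by rewrite invr1 !subrr powRr0 powRr1// !mul1r mul0r addr0.
have q1n0 : q - 1 != 0 by rewrite subr_eq0 gt_eqF.
pose e := (q - 1) / q.
have := @conjugate_powR R (D * K `^ (- e)) (K `^ e) q (q / (q - 1)).
rewrite mulr_ge0 ?powR_ge0// divr_gt0 ?subr_gt0// q0.
move=> /(_ isT isT isT isT) => /(_ _).
rewrite -mulrA -powRD ?addNr ?eqxx ?powRr0 ?mulr1; last by rewrite gt_eqF.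
rewrite powRM ?powR_ge0// -!powRrM.
have -> : - e * q = 1 - q by rewrite /e; field.
have -> : e * (q / (q - 1)) = 1 by rewrite /e; field; rewrite qn0 q1n0.
rewrite (powRr1 (ltW K0)) => h; apply: le_trans (h _) _.
  by field; rewrite qn0 q1n0.
rewrite (_ : K / (q / (q - 1)) = (1 - q^-1) * K); last first.
  by field; rewrite qn0 q1n0.
by rewrite (_ : _ / q = q^-1 * K `^ (1 - q) * D `^ q)//; ring.
Qed.

(** The factor 1/4 is the integral of t t' over the unit square, in the
    parameters t and t' of the segments that span a quadrant. The minimum over
    K is N 4^(1/q - 1) B^(1/q), which is not larger than the bound here. *)
Lemma young_optimal (R : realType) (q B N I : R) : 1 <= q -> 0 <= B -> 0 <= N ->
  (forall K, 0 < K ->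
    I <= N * (q^-1 * K `^ (1 - q) * B + (1 - q^-1) * K / 4)) ->
  I <= N * (2 `^ (2 - 2 / q) * B `^ (1 / q)).
Proof.
move=> q1; have q0 : 0 < q by exact: lt_le_trans q1.
have qn0 : q != 0 by exact: lt0r_neq0.
have iq1 : q^-1 <= 1 by rewrite invf_le1.
rewrite le_eqVlt => /predU1P[<-|B0] N0 hI.
  rewrite powR0 ?mulr0; last by rewrite div1r invr_eq0.
  (* For B = 0 the bound tends to 0 with K; a small multiple of I suffices. *)
  rewrite leNgt; apply/negP => I0.
  have N1 : 0 < N + 1 by lra.
  pose K := I / (N + 1); have K0 : 0 < K by exact: divr_gt0.
  have iq0 : 0 < q^-1 by rewrite invr_gt0.
  have NK : N * K <= I by rewrite mulrA ler_pdivrMr//; nra.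
  have NKq : 0 <= N * K * q^-1.
    by apply: mulr_ge0 (ltW iq0); exact: mulr_ge0 (ltW K0).
  have := hI K K0; rewrite mulr0 add0r.
  have -> : N * ((1 - q^-1) * K / 4) = (N * K - N * K * q^-1) / 4 by field.
  by lra.
(* The minimizer, at which both terms are multiples of K. *)
pose K := (4 * B) `^ (1 / q).
have B4 : 0 < 4 * B by rewrite mulr_gt0.
have K0 : 0 < K by exact: powR_gt0.
have Kq : K `^ q = 4 * B by rewrite /K -powRrM div1r mulVf// powRr1// ltW.
have KB : K `^ (1 - q) * B = K / 4.
  rewrite powRB; last by rewrite (gt_eqF K0) implybT.
  by rewrite Kq (powRr1 (ltW K0)); field; rewrite (gt_eqF B0).
apply: le_trans (hI K K0) _; apply: ler_wpM2l => //.
rewrite -mulrA KB.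
have -> : q^-1 * (K / 4) + (1 - q^-1) * K / 4 = 4 `^ (1 / q) / 4 * B `^ (1 / q).
  by rewrite /K powRM ?(ltW B0)//; field.
apply: ler_wpM2r; first exact: powR_ge0.
(* The constant 4^(1/q - 1) of the minimum is at most 1. *)
apply: (@le_trans _ _ 1).
  rewrite ler_pdivrMr// !mul1r -[leRHS]powRr1//.
  by apply: ler_powR => //; lra.
apply: (@le_trans _ _ (2 `^ 0)); first by rewrite powRr0.
apply: ler_powR; first by lra.
by rewrite subr_ge0 ler_pdivrMr//; lra.
Qed.

Lemma powR_div_sqr (R : realType) (q s S : R) : 0 < s -> 0 <= S ->
  (S / ((s + 1) ^+ 2 * (s + 2) ^+ 2)) `^ (1 / q) =
  S `^ (1 / q) / ((s + 1) `^ (2 / q) * (s + 2) `^ (2 / q)).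
Proof.
move=> s0 S0; have s1 : 0 < s + 1 by lra.
have s2 : 0 < s + 2 by lra.
have sqr_powR z : 0 < z -> z `^ (2 / q) = (z ^+ 2) `^ (1 / q).
  by move=> z0; rewrite -(powR_mulrn _ (ltW z0)) -powRrM mul1r.
have d0 : 0 < (s + 1) ^+ 2 * (s + 2) ^+ 2 by rewrite mulr_gt0// exprn_gt0.
have -> : (s + 1) `^ (2 / q) * (s + 2) `^ (2 / q) =
    ((s + 1) ^+ 2 * (s + 2) ^+ 2) `^ (1 / q).
  by rewrite !sqr_powR// powRM// sqr_ge0.
move: (_ * _) d0 => m m0.
apply: (canRL (mulfK _)); first by rewrite gt_eqF// powR_gt0.
by rewrite -powRM ?divfK ?(gt_eqF m0)// ?divr_ge0// ltW.
Qed.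

(** * The bound on one quadrant *)

Section Bounds.
Variables (R : realType) (a b c d q s : R) (f : R -> R -> R).
Hypotheses (ab : a < b) (cd : c < d) (q1 : 1 <= q) (s0 : 0 < s).
Hypothesis hf : partial_differentiable `[a, b] `[c, d] f.
Local Notation D u v := `|partial12 `[a, b] `[c, d] f u v|.
Hypothesis hconv : coord_s_convex2 s `[a, b] `[c, d] (fun u v => D u v `^ q).
Implicit Types (p x r y t z K : R).

(** Young's inequality is applied before the convexity bound, so that the
    latter enters linearly and its primitives are explicit; al names the factor
    of D^q in that inequality. *)
Lemma partial12_le K al p x r y t z : 0 < K -> al = q^-1 * K `^ (1 - q) ->
  a <= p <= b -> a <= x <= b -> c <= r <= d -> c <= y <= d ->
  0 <= t <= 1 -> 0 <= z <= 1 ->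
  D (p + t * (x - p)) (r + z * (y - r)) <=
  biweight s 0 0 (al * D x y `^ q) (al * D x r `^ q) (al * D p y `^ q)
    (al * D p r `^ q) ((1 - q^-1) * K) t z.
Proof.
move=> K0 alE pab xab rcd ycd t01 z01.
have al0 : 0 <= al.
  by rewrite alE mulr_ge0 ?powR_ge0// invr_ge0; apply: le_trans q1.
apply: le_trans (young_powR q1 K0 _) _ => //.
have vcd := segment_in_itv rcd ycd z01.
have hG := coord_s_convex2_le hconv (p := p) (x := x) (r := r) (y := y)
  (t := t) (z := z).
rewrite /= !in_itv/= in hG.
have {}hG := hG pab xab rcd ycd vcd t01 z01.
by rewrite biweight00_affine -alE lerD2r; apply: ler_wpM2l.
Qed.

(** The corners of the rectangle control the whole rectangle: convexity turns
    finitely many values of D into a uniform bound. *)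
Lemma partial12_bounded : exists C,
  forall u v, a <= u <= b -> c <= v <= d -> D u v <= C.
Proof.
(* The bound of partial12_le over the whole rectangle, with K = 1. *)
exists (q^-1 * 1 `^ (1 - q) * D b d `^ q + q^-1 * 1 `^ (1 - q) * D b c `^ q
  + q^-1 * 1 `^ (1 - q) * D a d `^ q + q^-1 * 1 `^ (1 - q) * D a c `^ q
  + (1 - q^-1) * 1) => u v uab vcd.
have aab : a <= a <= b by rewrite lexx ltW.
have bab : a <= b <= b by rewrite lexx ltW.
have ccd : c <= c <= d by rewrite lexx ltW.
have dcd : c <= d <= d by rewrite lexx ltW.
have ratio (m n w : R) : m < n -> m <= w <= n ->
    0 <= (w - m) / (n - m) <= 1 /\ m + (w - m) / (n - m) * (n - m) = w.
  move=> mn /andP[mw wn]; split; last by rewrite divfK ?subrKC// gt_eqF// subr_gt0.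
  by rewrite divr_ge0 ?subr_ge0 ?(ltW mn)//= ler_pdivrMr ?subr_gt0// mul1r lerD2r.
have [t01 uE] := ratio _ _ _ ab uab; have [z01 vE] := ratio _ _ _ cd vcd.
have := partial12_le ltr01 erefl aab bab ccd dcd t01 z01.
rewrite uE vE => /le_trans; apply.
by apply: biweight00_le => //;
  rewrite !mulr_ge0 ?powR_ge0// invr_ge0; apply: le_trans q1.
Qed.

Lemma quadrant_le p x r y al be ga de :
  a <= p <= b -> a <= x <= b -> c <= r <= d -> c <= y <= d ->
  Num.min p x = al -> Num.max p x = be ->
  Num.min r y = ga -> Num.max r y = de ->
  `|corner_integral f p r al be ga de|
  <= 2 `^ (2 - 2 / q) / ((s + 1) `^ (2 / q) * (s + 2) `^ (2 / q)) *
     ((x - p) ^+ 2 * (y - r) ^+ 2 *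
       (D x y `^ q + (s + 1) * D x r `^ q + (s + 1) * D p y `^ q
         + (s + 1) ^+ 2 * D p r `^ q) `^ (1 / q)).
Proof.
move=> pab xab rcd ycd alE beE gaE deE.
have [C f12C] := partial12_bounded.
set S := _ + (s + 1) ^+ 2 * _.
have s1 : 0 < s + 1 by exact: addr_gt0.
have s2 : 0 < s + 2 by exact: addr_gt0.
have S0 : 0 <= S.
  by rewrite /S !addr_ge0// ?mulr_ge0 ?powR_ge0 ?exprn_ge0// ltW.
set c0 := (X in _ <= X * _).
rewrite (_ : c0 * _ = (x - p) ^+ 2 * (y - r) ^+ 2 * (2 `^ (2 - 2 / q) *
    (S / ((s + 1) ^+ 2 * (s + 2) ^+ 2)) `^ (1 / q))); last first.
  rewrite powR_div_sqr// /c0; move: (S `^ _) => S'; ring.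
apply: young_optimal => //.
- by rewrite divr_ge0// mulr_ge0 ?exprn_ge0 ?ltW.
- by rewrite mulr_ge0 ?sqr_ge0.
move=> K K0.
have hb t z : 0 < t < 1 -> 0 < z < 1 -> _ :=
  fun t01 z01 => partial12_le K0 erefl pab xab rcd ycd
    (ltW_itv t01) (ltW_itv z01).
apply: le_trans (corner_integral_le ab cd hf f12C s0 pab xab rcd ycd hb
  alE beE gaE deE) _.
by rewrite biweight22_1.
Qed.

End Bounds.

Lemma norm_div_sum4_le (R : realType)
    (k c0 E E1 E2 E3 E4 n1 n2 n3 n4 S1 S2 S3 S4 : R) :
  0 < k -> `|E1| <= c0 * (n1 * S1) -> `|E2| <= c0 * (n2 * S2) ->
  `|E3| <= c0 * (n3 * S3) -> `|E4| <= c0 * (n4 * S4) -> E = E1 + E2 + E3 + E4 ->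
  `|1 / k * E| <=
    c0 * (n1 / k * S1 + n2 / k * S2 + n3 / k * S3 + n4 / k * S4).
Proof.
move=> k0 h1 h2 h3 h4 ->; rewrite normrM div1r gtr0_norm ?invr_gt0//.
rewrite ler_pdivrMl//.
apply: (@le_trans _ _ (`|E1| + `|E2| + `|E3| + `|E4|)).
  by do 3 (apply: le_trans (ler_normD _ _) _; rewrite lerD2r//).
rewrite (_ : k * _ = c0 * (n1 * S1) + c0 * (n2 * S2) + c0 * (n3 * S3)
  + c0 * (n4 * S4)); last by field; rewrite gt_eqF.
by rewrite !lerD.
Qed.

Theorem theorem4 (R : realType) (a b c d : R) (f : R -> R -> R) (q s : R)
  (ha : 0 <= a) (hab : a < b) (hc : 0 <= c) (hcd : c < d)
  (hf : partial_differentiable `[a, b] `[c, d] f)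
  (hint : ((@lebesgue_measure R) \x (@lebesgue_measure R))%E.-integrable
            (`[a, b] `*` `[c, d])
            (fun p : R * R => (partial12 `[a, b] `[c, d] f p.1 p.2)%:E))
  (hq : 1 <= q) (hs0 : 0 < s) (hs1 : s <= 1)
  (hconv : coord_s_convex2 s `[a, b] `[c, d]
             (fun u v => `|partial12 `[a, b] `[c, d] f u v| `^ q))
  (x y : R) (hx : a <= x <= b) (hy : c <= y <= d) :
  let D := fun u v : R => `|partial12 `[a, b] `[c, d] f u v| in
  let A := (x - a) * (y - c) * f a c + (x - a) * (d - y) * f a d
         + ((b - x) * (y - c) * f b c + (b - x) * (d - y) * f b d) in
  `| 1 / ((b - a) * (d - c)) *
     (A - (x - a) * \int[@lebesgue_measure R]_(v in `[c, d]) f a v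
        - (b - x) * \int[@lebesgue_measure R]_(v in `[c, d]) f b v
        - (d - y) * \int[@lebesgue_measure R]_(u in `[a, b]) f u d
        - (y - c) * \int[@lebesgue_measure R]_(u in `[a, b]) f u c
        + \int[@lebesgue_measure R]_(u in `[a, b])
            (\int[@lebesgue_measure R]_(v in `[c, d]) f u v)) |
  <= 2 `^ (2 - 2 / q) / ((s + 1) `^ (2 / q) * (s + 2) `^ (2 / q)) *
     ( (x - a) ^+ 2 * (y - c) ^+ 2 / ((b - a) * (d - c)) *
         (D x y `^ q + (s + 1) * D x c `^ q + (s + 1) * D a y `^ q
           + (s + 1) ^+ 2 * D a c `^ q) `^ (1 / q)
     + (x - a) ^+ 2 * (d - y) ^+ 2 / ((b - a) * (d - c)) *
         (D x y `^ q + (s + 1) * D x d `^ q + (s + 1) * D a y `^ q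
           + (s + 1) ^+ 2 * D a d `^ q) `^ (1 / q)
     + (b - x) ^+ 2 * (y - c) ^+ 2 / ((b - a) * (d - c)) *
         (D x y `^ q + (s + 1) * D x c `^ q + (s + 1) * D b y `^ q
           + (s + 1) ^+ 2 * D b c `^ q) `^ (1 / q)
     + (b - x) ^+ 2 * (d - y) ^+ 2 / ((b - a) * (d - c)) *
         (D x y `^ q + (s + 1) * D x d `^ q + (s + 1) * D b y `^ q
           + (s + 1) ^+ 2 * D b d `^ q) `^ (1 / q)).
Proof.
cbv beta zeta.
have aab : a <= a <= b by rewrite lexx ltW.
have bab : a <= b <= b by rewrite lexx ltW.
have ccd : c <= c <= d by rewrite lexx ltW.
have dcd : c <= d <= d by rewrite lexx ltW.
have [[ax xb] [cy yd]] := (andP hx, andP hy).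
have Q := quadrant_le hab hcd hq hs0 hf hconv.
have qac := Q _ _ _ _ _ _ _ _ aab hx ccd hy
  (min_l ax) (max_r ax) (min_l cy) (max_r cy).
have qad := Q _ _ _ _ _ _ _ _ aab hx dcd hy
  (min_l ax) (max_r ax) (min_r yd) (max_l yd).
have qbc := Q _ _ _ _ _ _ _ _ bab hx ccd hy
  (min_r xb) (max_l xb) (min_l cy) (max_r cy).
have qbd := Q _ _ _ _ _ _ _ _ bab hx dcd hy
  (min_r xb) (max_l xb) (min_r yd) (max_l yd).
have sqrC (u v : R) : (u - v) ^+ 2 = (v - u) ^+ 2 by ring.
rewrite (sqrC y d) in qad; rewrite (sqrC x b) in qbc.
rewrite (sqrC y d) (sqrC x b) in qbd.
have k0 : 0 < (b - a) * (d - c) by rewrite mulr_gt0// subr_gt0.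
apply: (norm_div_sum4_le k0 qac qad qbc qbd).
have [C f12C] := partial12_bounded hab hcd hq hs0 hconv.
exact: (bracket_eq_corner_integrals hab hcd hf f12C).
Qed.
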